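(* For all nonnegative integers $d_1,d_2$, $$\sum_{i=0}^{d_1}\sum_{j=0}^{d_2}q^{2d_1j-2ij-2i-2j}\,\frac{\binom{d_1}{i}_{q^2}\binom{d_2}{j}_{q^2}}{\binom{d_1+d_2}{i+j}_{q^2}}=\frac{1-q^{2(d_1+d_2)+2}}{q^{2d_1+2d_2}(1-q^2)}.$$
   Context: $q$ is real, $q\notin\{0,1,-1\}$. $\binom{N}{j}_{q^2}=\frac{(q^2;q^2)_N}{(q^2;q^2)_j(q^2;q^2)_{N-j}}$ is the Gaussian binomial coefficient, where $(x;p)_N=\prod_{i=0}^{N-1}(1-xp^i)$ and $(x;p)_0=1$. *)

(* Defs.v *)
From HB Require Import structures.
From mathcomp Require Import all_boot all_order all_algebra.

Set Implicit Arguments.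
Unset Strict Implicit.
Unset Printing Implicit Defensive.

Import GRing.Theory.
Local Open Scope ring_scope.

(* The finite q-shifted factorial (x; p)_N. *)
Definition qpoch (F : fieldType) (x p : F) (N : nat) : F :=
  \prod_(i < N) (1 - x * p ^+ i).

(* The Gaussian binomial coefficient with base p. It is meant for j <= N only:
   N - j is truncated, so the value is not 0 when j > N. *)
Definition gauss_binom (F : fieldType) (p : F) (N j : nat) : F :=
  qpoch p p N / (qpoch p p j * qpoch p p (N - j)).

(* Main.v *)
(** With p = q^2, the q-binomial theorem expands
    prod_(i < N) (1 + p^i X) = sum_k p^(k choose 2) [N, k]_p X^k.
    Splitting the product for N = d1 + d2 after its first d1 factors and
    comparing coefficients gives the q-Vandermonde identity
    sum_(i + j = k) p^((d1 - i) j) [d1, i] [d2, j] = [d1 + d2, k].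
    Hence the terms with i + j = k of the double sum add up to p^(-k), and a
    geometric series remains. *)
Require Import Defs.
From HB Require Import structures.
From mathcomp Require Import all_boot all_order all_algebra.
From mathcomp Require Import zify ring.

Set Implicit Arguments.
Unset Strict Implicit.
Unset Printing Implicit Defensive.

Import Order.TTheory GRing.Theory Num.Theory.
Local Open Scope ring_scope.

(** The cross term [i * j] is what produces the factor q^(-2ij) in the weight of the double sum. *)
Lemma bin2D i j : 'C(i + j, 2) = ('C(i, 2) + 'C(j, 2) + i * j)%N.
Proof.
elim: j => [|j IHj]; first by rewrite addn0 muln0 !addn0.
by rewrite addnS !binS !bin1 IHj; lia.
Qed.

Section QBinomial.

Variables (F : fieldType) (p : F).
Hypothesis p_not_root1 : forall n, p ^+ n.+1 != 1.

Lemma qpochS n : qpoch p p n.+1 = qpoch p p n * (1 - p ^+ n.+1).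
Proof. by rewrite /qpoch big_ord_recr /= -exprS. Qed.

Lemma subr1_expr_neq0 n : 1 - p ^+ n.+1 != 0.
Proof. by rewrite subr_eq0 eq_sym. Qed.

Lemma qpoch_neq0 n : qpoch p p n != 0.
Proof.
elim: n => [|n IHn]; first by rewrite /qpoch big_ord0 oner_neq0.
by rewrite qpochS mulf_neq0 ?subr1_expr_neq0.
Qed.

Lemma gauss_binom_neq0 n k : gauss_binom p n k != 0.
Proof. by rewrite mulf_neq0 ?invr_neq0 ?mulf_neq0 ?qpoch_neq0. Qed.

Lemma gauss_binom0 n : gauss_binom p n 0 = 1.
Proof.
by rewrite /gauss_binom subn0 [qpoch p p 0]/qpoch big_ord0 mul1r divff ?qpoch_neq0.
Qed.

Lemma gauss_binomn n : gauss_binom p n n = 1.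
Proof.
rewrite /gauss_binom subnn [qpoch p p 0]/qpoch big_ord0 mulr1.
by rewrite divff ?qpoch_neq0.
Qed.

(** A q-Pascal rule: with n = k + r + 1, x = p^(k+1) and y = p^(r+1), it reduces to 1 - xy = (1 - y)
    + y(1 - x). The case k = n is excluded, since [gauss_binom p n n.+1] is not 0. *)
Lemma gauss_binomS n k : (k < n)%N ->
  gauss_binom p n.+1 k.+1 =
  gauss_binom p n k.+1 + p ^+ (n - k) * gauss_binom p n k.
Proof.
move=> lt_kn; have [r ->] : exists r, n = (k + r).+1.
  by exists (n - k.+1)%N; lia.
rewrite /gauss_binom.
have -> : ((k + r).+2 - k.+1 = r.+1)%N by lia.
have -> : ((k + r).+1 - k.+1 = r)%N by lia.
have -> : ((k + r).+1 - k = r.+1)%N by lia.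
rewrite !(qpochS (k + r).+1) !(qpochS k) !(qpochS r).
have -> : p ^+ (k + r).+2 = p ^+ k.+1 * p ^+ r.+1.
  by rewrite -exprD; congr (_ ^+ _); lia.
have := qpoch_neq0 k; have := qpoch_neq0 r.
have := subr1_expr_neq0 k; have := subr1_expr_neq0 r.
move: (p ^+ k.+1) (p ^+ r.+1) => x y ny nx nr nk.
by field; rewrite nx ny nr nk.
Qed.

Definition qprod n : {poly F} := \prod_(i < n) (1 + p ^+ i *: 'X).

Lemma qprodS n : qprod n.+1 = qprod n + p ^+ n *: (qprod n * 'X).
Proof. by rewrite /qprod big_ord_recr /= mulrDr mulr1 -scalerAr. Qed.

Lemma size_qprod n : (size (qprod n) <= n.+1)%N.
Proof.
elim: n => [|n IHn]; first by rewrite /qprod big_ord0 size_poly1.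
rewrite qprodS (leq_trans (size_polyD _ _)) // geq_max (leqW IHn) /=.
rewrite (leq_trans (size_scale_leq _ _)) //.
by rewrite (leq_trans (size_polyMleq _ _)) // size_polyX addn2.
Qed.

Lemma coef_qprod n k : (k <= n)%N ->
  (qprod n)`_k = p ^+ 'C(k, 2) * gauss_binom p n k.
Proof.
elim: n k => [|n IHn] [|k] // le_kn.
- by rewrite /qprod big_ord0 coef1 gauss_binom0 mulr1.
- by rewrite qprodS coefD coefZ coefMX /= mulr0 addr0 IHn // !gauss_binom0.
rewrite qprodS coefD coefZ coefMX (IHn k) //= binS bin1.
move: le_kn; rewrite ltnS leq_eqVlt => /predU1P[->|lt_kn].
  rewrite nth_default ?size_qprod // !gauss_binomn exprD; ring.
have -> : p ^+ n = p ^+ (n - k) * p ^+ k by rewrite -exprD subnK // ltnW.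
rewrite IHn // gauss_binomS // binS bin1 exprD; ring.
Qed.

Lemma qprodE n :
  qprod n = \sum_(i < n.+1) (p ^+ 'C(i, 2) * gauss_binom p n i) *: 'X^i.
Proof.
rewrite -(coefK (qprod n)) poly_def.
rewrite (big_ord_widen _ (fun i => (qprod n)`_i *: 'X^i) (size_qprod n)).
rewrite big_mkcond; apply: eq_bigr => i _; rewrite -coef_qprod -1?ltnS //.
by case: ltnP => // le_ni; rewrite nth_default // scale0r.
Qed.

(** The last n factors are 1 + p^i (p^m X) for i < n, that is, [qprod n] with X rescaled by p^m. *)
Lemma qprodD m n : qprod (m + n) = qprod m * (qprod n \Po (p ^+ m *: 'X)).
Proof.
rewrite {1}/qprod big_split_ord; congr (_ * _).
rewrite /qprod rmorph_prod; apply: eq_bigr => i _ /=.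
by rewrite rmorphD rmorph1 /= comp_polyZ comp_polyX scalerA -exprD addnC.
Qed.

(* The powers of p are kept as in the product expansion: their quotient is
   p ^ (m j - i j), which need not be read with truncated subtraction. *)
Lemma q_vandermonde m n k : (k <= m + n)%N ->
  \sum_(i < m.+1) \sum_(j < n.+1)
     (p ^+ ('C(i, 2) + 'C(j, 2) + m * j)
      * (gauss_binom p m i * gauss_binom p n j)) *+ (k == i + j)%N
  = p ^+ 'C(k, 2) * gauss_binom p (m + n) k.
Proof.
move=> le_kmn; rewrite -coef_qprod // qprodD !qprodE rmorph_sum /=.
rewrite big_distrlr coef_sum; apply: eq_bigr => i _ /=.
rewrite coef_sum; apply: eq_bigr => j _ /=.
rewrite comp_polyZ comp_Xn_poly exprZn scalerA -scalerAl -scalerAr scalerA.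
rewrite -exprD coefZ coefXn mulr_natr -exprM !exprD.
by congr (_ *+ _); ring.
Qed.

End QBinomial.

Lemma sum_exprVn (F : fieldType) (p : F) n : p != 0 -> 1 - p != 0 ->
  \sum_(k < n.+1) (p ^+ k)^-1 = (1 - p ^+ n.+1) / (p ^+ n * (1 - p)).
Proof.
move=> p0 p1; elim: n => [|n IHn].
  by rewrite big_ord_recr big_ord0 /= !expr0; field; rewrite p1 oner_neq0.
rewrite big_ord_recr /= IHn !exprS.
have := expf_neq0 n p0; move: (p ^+ n) => x x0.
by field; rewrite p1 x0 p0.
Qed.

Theorem proposition5p3 (R : realFieldType) (q : R)
    (q_neq0 : q != 0) (q_neq1 : q != 1) (q_neqN1 : q != -1) (d1 d2 : nat) :
  \sum_(0 <= i < d1.+1) \sum_(0 <= j < d2.+1)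
     q ^ (2 * d1%:Z * j%:Z - 2 * i%:Z * j%:Z - 2 * i%:Z - 2 * j%:Z)
     * (gauss_binom (q ^+ 2) d1 i * gauss_binom (q ^+ 2) d2 j
        / gauss_binom (q ^+ 2) (d1 + d2) (i + j))
  = (1 - q ^+ (2 * (d1 + d2) + 2))
    / (q ^+ (2 * d1 + 2 * d2) * (1 - q ^+ 2)).
Proof.
set p := q ^+ 2; have p0 : p != 0 by rewrite expf_neq0.
have p1 : p != 1 by rewrite sqrf_eq1 negb_or q_neq1.
(* The order on [R] enters here: p is a square, hence nonnegative, and a nonnegative element with a
   positive power equal to 1 is 1. *)
have pn n : p ^+ n.+1 != 1 by rewrite pexpr_eq1 ?sqr_ge0.
(* The numerator is the weight in q-Vandermonde; the denominator depends only on k = i + j. *)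
have powE i j :
    q ^ (2 * d1%:Z * j%:Z - 2 * i%:Z * j%:Z - 2 * i%:Z - 2 * j%:Z) =
    p ^+ ('C(i, 2) + 'C(j, 2) + d1 * j) / p ^+ ('C(i + j, 2) + (i + j)).
  apply: (canRL (mulfK _)); first by rewrite expf_neq0.
  rewrite -!exprM !exprnP -expfzDr //; congr (_ ^ _).
  by rewrite bin2D; lia.
(* [w k] collects the factors that depend only on k = i + j; multiplying the q-Vandermonde sum by it
   leaves p^(-k). *)
pose w k := (p ^+ ('C(k, 2) + k) * gauss_binom p (d1 + d2) k)^-1.
transitivity (\sum_(k < (d1 + d2).+1) \sum_(i < d1.+1) \sum_(j < d2.+1)
    (p ^+ ('C(i, 2) + 'C(j, 2) + d1 * j)
     * (gauss_binom p d1 i * gauss_binom p d2 j)) *+ (val k == i + j)%N * w k).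
  (* The sum over k is moved innermost, where only k = i + j survives. *)
  rewrite big_mkord [RHS]exchange_big; apply: eq_bigr => i _ /=.
  rewrite big_mkord [RHS]exchange_big; apply: eq_bigr => j _ /=.
  have ltij : (i + j < (d1 + d2).+1)%N by rewrite ltnS leq_add // -ltnS.
  rewrite (bigD1 (Ordinal ltij)) //= eqxx mulr1n big1 ?addr0; last first.
    by move=> k /negbTE nk; rewrite -val_eqE /= in nk; rewrite nk mulr0n mul0r.
  by rewrite powE mulf_div.
transitivity (\sum_(k < (d1 + d2).+1) (p ^+ k)^-1).
  apply: eq_bigr => k _.
  under eq_bigr do rewrite -mulr_suml.
  rewrite -mulr_suml (q_vandermonde pn (leq_ord k)) /w exprD.
  have := gauss_binom_neq0 pn (d1 + d2) k.
  have := expf_neq0 'C(k, 2) p0; have := expf_neq0 k p0.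
  by move=> n1 n2 n3; field; rewrite n1 n2 n3.
rewrite sum_exprVn // ?subr_eq0 1?[1 == p]eq_sym // -!exprM.
by rewrite mulnS addnC mulnDr.
Qed.
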